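(* Suppose there exists a finite colouring $\theta$ of $\mathbb{N}^{(2)}$ such that there do not exist natural numbers $m_1<m_2<\cdots$ for which all pairs $(m_{k_1}-m_{k_2}+m_{k_3}-\cdots+m_{k_t},\ m_{k_{t+1}})$, with $t$ odd and $k_1<\cdots<k_{t+1}$, have the same $\theta$-colour. Then for every alphabet $X$ and every infinite word $x$ on $X$ that is not eventually periodic, there exists a finite colouring of $X^*$ such that no suffix of $x$ has a super-monochromatic factorisation.
   Context: $\mathbb{N}^{(2)}$ denotes the set of pairs $(a,b)$ of natural numbers with $a<b$. $X^*$ is the set of finite words over $X$. An infinite word is $x=x_1x_2\cdots$ with $x_i\in X$; a suffix is $x_nx_{n+1}\cdots$ for some $n\ge1$; $x$ is eventually periodic if some suffix equals $uuu\cdots$ for a non-empty finite word $u$. A factorisation of an infinite word $y$ is a sequence of non-empty finite words $u_1,u_2,\dots$ with $y=u_1u_2\cdots$; for a colouring of $X^*$ it is super-monochromatic if all words $u_{k_1}\cdots u_{k_n}$ ($n\ge1$, $k_1<\cdots<k_n$) have the same colour. (In the paper this theorem is phrased as ''Theorem 2 implies Theorem 1'', where Theorem 2 asserts existence of such a $\theta$ and Theorem 1 is the characterisation of eventually periodic words by super-monochromatic factorisations of suffixes.) *)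

(* Defs.v *)
From mathcomp Require Import all_boot all_order all_algebra.

Set Implicit Arguments.
Unset Strict Implicit.
Unset Printing Implicit Defensive.

Import GRing.Theory.

Definition strictly_increasing (m : nat -> nat) : Prop :=
  {homo m : i j / (i < j)%N}.

Definition natpair : Type := {p : nat * nat | p.1 < p.2}.

(* The alternating sum is computed in [int], where subtraction is not
   truncated. For strictly increasing [m] and [k], with [t] odd, it lies
   between [m k_0] and [m k_(t-1)], so every such [t] and [k] does give an
   element of [natpair]. *)
Definition alternating_pair (m : nat -> nat) (p : natpair) : Prop :=
  exists (t : nat) (k : seq nat),
    [/\ odd t, size k = t.+1, sorted ltn k,
        ((val p).1%:Z = \sum_(i < t) (-1) ^+ i * (m (nth 0%N k i))%:Z)%R
      & (val p).2 = m (nth 0 k t)].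

Definition alternating_monochromatic (C : finType) (theta : natpair -> C)
    (m : nat -> nat) : Prop :=
  exists c : C, forall p : natpair, alternating_pair m p -> theta p = c.

(* An infinite word x_1 x_2 ... is a function [x : nat -> X], with [x i]
   standing for the letter x_(i+1). *)
Definition suffix_from (X : Type) (n : nat) (x : nat -> X) : nat -> X :=
  fun i => x (n + i).

Definition concat_at (X : Type) (u : nat -> seq X) (k : seq nat) : seq X :=
  flatten [seq u i | i <- k].

(* y = u_0 u_1 u_2 ... with every u_i non-empty: each finite product
   u_0 ... u_(n-1) is a prefix of y, and since the lengths of these products
   are unbounded, they determine y. *)
Definition factorisation (X : Type) (y : nat -> X) (u : nat -> seq X) : Prop :=
  (forall i, u i <> [::]) /\
  (forall n, concat_at u (iota 0 n) = mkseq y (size (concat_at u (iota 0 n)))).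

Definition eventually_periodic (X : Type) (x : nat -> X) : Prop :=
  exists (n : nat) (u : seq X),
    u <> [::] /\ factorisation (suffix_from n x) (fun=> u).

Definition super_monochromatic (X : Type) (D : finType) (c : seq X -> D)
    (u : nat -> seq X) : Prop :=
  exists d : D, forall k : seq nat,
    k <> [::] -> sorted ltn k -> c (concat_at u k) = d.

(* Main.v *)
Require Import Defs.
From mathcomp Require Import all_boot all_order all_algebra.
From mathcomp Require Import boolp zify.

(** Let [x] be not eventually periodic. Each block [x_a ... x_(b-1)] with [b]
    large compared to [a] occurs in [x] at no position before [a], so some slowly
    growing [h] has this property for all [a <= 2 h(b)]. Given a word [w], delete
    its first [h(|w|)] letters, let [e] be the end of the first occurrence in [x]
    of what remains, and give [w] the [theta]-colour of [(e - |w|, e)].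

    In a super-monochromatic factorisation, merge consecutive factors until each
    is very long compared to the position where it starts, and let [m_i] be the
    new cut points. For [k_1 < ... < k_(t+1)] with [t] odd, let [w] be the product
    of the blocks of [x] between [m_(k_1)] and [m_(k_2)], between [m_(k_3)] and
    [m_(k_4)], and so on. The last block is so much longer than the earlier ones
    that what remains of [w] is a long final piece of it. Hence
    [e = m_(k_(t+1))], while [e - |w| = m_(k_1) - m_(k_2) + ... + m_(k_t)]. *)

(** A mismatch is asked for inside the block, so for [a > 0] this also forces [a < b]. *)
Definition new_block (X : Type) (x : nat -> X) (a b : nat) : Prop :=
  forall a', a' < a -> exists2 i, a + i < b & x (a' + i) <> x (a + i).

Lemma new_block_leq (X : Type) (x : nat -> X) a b c :
  b <= c -> new_block X x a b -> new_block X x a c.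
Proof.
by move=> bc ab a' /ab[i ib xi]; exists i => //; apply: leq_trans bc.
Qed.

Lemma new_block_unique (X : Type) (x : nat -> X) a b l :
  new_block X x a (a + l) -> new_block X x b (b + l) ->
  mkseq (suffix_from a x) l = mkseq (suffix_from b x) l -> a = b.
Proof.
move=> na nb eab.
have xE i : i < l -> x (a + i) = x (b + i).
  move=> il; have := congr1 (fun s => nth (x 0) s i) eab.
  by rewrite !nth_mkseq.
case: (ltngtP a b) => // [/nb|/na] [i]; rewrite ltn_add2l => /xE.
  by move=> ->.
by move=> ->.
Qed.

Lemma periodic_factorisation (X : Type) (y : nat -> X) d :
  0 < d -> (forall i, y (d + i) = y i) ->
  factorisation y (fun=> mkseq y d).
Proof.
move=> d_gt0 yd; set u := mkseq y d.
have szu : size u = d by rewrite size_mkseq.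
split=> [_|n]; first by move=> u0; rewrite -szu u0 in d_gt0.
have ymul k i : y (k * d + i) = y i.
  by elim: k => [|k IH] //; rewrite mulSn -addnA yd.
elim: n => [|n IH] //.
have szn k : size (concat_at (fun=> u) (iota 0 k)) = k * d.
  elim: k => // k IHk; rewrite -addn1 iotaD /concat_at map_cat flatten_cat.
  by rewrite size_cat -/(concat_at _ _) IHk /= cats0 szu addn1 mulSn addnC.
rewrite szn mulSn addnC -[in LHS]addn1 iotaD /concat_at map_cat flatten_cat.
rewrite -/(concat_at _ _) IH szn /= cats0 /mkseq iotaD map_cat; congr (_ ++ _).
rewrite add0n -[in RHS](addn0 (n * d)) iotaDl -map_comp.
by apply: eq_map => i /=; rewrite ymul.
Qed.

(** If [x] read from some [a' < a] agreed with [x] read from [a], it would have period [a - a'] from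
    [a'] on. So each of the finitely many [a'] gives a mismatch, and [b] is taken beyond them
    all. *)
Lemma new_block_exists (X : Type) (x : nat -> X) a :
  ~ eventually_periodic x -> exists b, new_block X x a b.
Proof.
move=> hx.
have diff a' : a' < a -> exists i, x (a' + i) <> x (a + i).
  move=> lta; apply: contrapT => same; apply: hx.
  have d_gt0 : 0 < a - a' by rewrite subn_gt0.
  exists a', (mkseq (suffix_from a' x) (a - a')); split.
    by case: (a - a') d_gt0.
  apply: periodic_factorisation => // i; apply: contrapT => neq; apply: same.
  exists i; rewrite /suffix_from in neq => eqx; apply: neq.
  by rewrite addnA subnKC ?(ltnW lta).
suff main c : c <= a -> exists b, forall a', a' < c ->
    exists2 i, a + i < b & x (a' + i) <> x (a + i).
  exact: main (leqnn a).
elim: c => [|c IH] ca; first by exists 0.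
have [b Pb] := IH (ltnW ca); have [i xi] := diff c ca.
exists (maxn b (a + i).+1) => a'; rewrite ltnS leq_eqVlt => /orP[/eqP->|/Pb].
  by exists i => //; rewrite leq_max leqnn orbT.
by case=> j jb xj; exists j => //; rewrite leq_max jb.
Qed.

Lemma slow_function (X : Type) (x : nat -> X) : ~ eventually_periodic x ->
  exists h B : nat -> nat,
    [/\ {homo h : i j / i <= j},
        forall j b, B j <= b -> j <= h b
      & forall b a, a <= (h b).*2 -> new_block X x a b].
Proof.
move=> hx.
pose Q j b := forall a, a <= j.*2 -> new_block X x a b.
pose h b := \max_(j < b.+1 | `[< Q j b >]) j.
have Q_leq j b c : b <= c -> Q j b -> Q j c.
  by move=> bc Qj a /Qj; apply: new_block_leq.
have Qex j : exists b, Q j b.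
  rewrite /Q; elim: j.*2 => [|k [b IH]].
    by exists 0 => a; rewrite leqn0 => /eqP->.
  have [b' Pb'] := new_block_exists X x k.+1 hx.
  exists (maxn b b') => a; rewrite leq_eqVlt => /orP[/eqP->|/IH].
    exact: new_block_leq (leq_maxr _ _) Pb'.
  exact: new_block_leq (leq_maxl _ _).
have [B0 B0P] := choice Qex.
have h_ge j b : j <= b -> Q j b -> j <= h b.
  move=> jb Qj; rewrite -ltnS in jb.
  by apply: (@leq_bigmax_cond _ _ _ (Ordinal jb)); apply/asboolP.
have hQ b : Q (h b) b.
  rewrite /h; elim/big_ind: _ => [a|j k Qj Qk|j /asboolP//].
    by rewrite leqn0 => /eqP->.
  by case/orP: (leq_total j k) => [/maxn_idPr|/maxn_idPl] ->.
(* The maximum [h b] runs over [j <= b] only, so the threshold for [j] must also be at least [j]. *)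
exists h, (fun j => maxn (B0 j) j); split=> //.
- move=> b c bc; apply: h_ge; last exact: Q_leq (hQ b).
  apply: leq_trans bc; apply/bigmax_leqP => j _; exact: ltn_ord j.
- move=> j b; rewrite geq_max => /andP[Bb jb].
  by apply: h_ge => //; apply: Q_leq (B0P j).
Qed.

(** [M i] is the position in [x] at which the factor [u i] starts. *)
Lemma factorisation_block (X : Type) (x : nat -> X) n (u : nat -> seq X) :
  factorisation (suffix_from n x) u ->
  exists2 M, strictly_increasing M
    & forall i j, i <= j ->
        concat_at u (iota i (j - i)) = mkseq (suffix_from (M i) x) (M j - M i).
Proof.
case=> u_neq0 uP.
pose L i := size (concat_at u (iota 0 i)).
have LD i d : L (i + d) = L i + size (concat_at u (iota i d)).
  by rewrite /L iotaD /concat_at map_cat flatten_cat size_cat.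
exists (fun i => n + L i).
  apply: homo_ltn; first exact: ltn_trans.
  move=> i; rewrite ltn_add2l -[i.+1]addn1 LD -[ltnLHS]addn0 ltn_add2l /concat_at /=.
  by rewrite cats0; case: (u i) (u_neq0 i).
move=> i j /subnKC <-; move: (j - i) => d; rewrite [i + d - i]addKn.
have := congr1 (drop (L i)) (uP (i + d)).
have mapD l : mkseq (suffix_from n x) (L i + l) =
    mkseq (suffix_from n x) (L i) ++ mkseq (suffix_from (n + L i) x) l.
  rewrite /mkseq iotaD map_cat add0n -[X in iota X l]addn0 iotaDl -map_comp.
  by congr (_ ++ _); apply: eq_map => e; rewrite /= /suffix_from addnA.
rewrite -/(L (i + d)) LD mapD iotaD /concat_at map_cat flatten_cat.
by rewrite -/(concat_at _ _) !drop_size_cat ?size_mkseq // addnA addKn.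
Qed.

(** The factors with these indices make up [r] blocks of [x], the first from [G 0] to [G 1], the
    next from [G 2] to [G 3], and so on. *)
Definition merged_indices (G : nat -> nat) (r : nat) : seq nat :=
  flatten [seq iota (G i.*2) (G i.*2.+1 - G i.*2) | i <- iota 0 r].

Lemma merged_indicesS G r :
  merged_indices G r.+1 =
  merged_indices G r ++ iota (G r.*2) (G r.*2.+1 - G r.*2).
Proof.
by rewrite /merged_indices -addn1 iotaD map_cat flatten_cat /= cats0.
Qed.

Lemma merged_indices_sorted G r : strictly_increasing G ->
  sorted ltn (merged_indices G r) && all (gtn (G r.*2)) (merged_indices G r).
Proof.
move=> G_incr; elim: r => [|r /andP[srt lt]] //.
have G1 := G_incr _ _ (ltnSn r.*2); have G2 := G_incr _ _ (ltnSn r.*2.+1).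
rewrite merged_indicesS !(sorted_pairwise ltn_trans) pairwise_cat.
rewrite -!(sorted_pairwise ltn_trans) srt iota_ltn_sorted /= andbT all_cat doubleS.
apply/and3P; split.
- apply/allrelP => i j /(allP lt) /= ilt; rewrite mem_iota => /andP[le _].
  exact: leq_trans ilt le.
- by apply: sub_all lt => i /= ilt; apply: ltn_trans ilt (ltn_trans G1 G2).
- apply/allP => i; rewrite mem_iota subnKC ?(ltnW G1) // => /andP[_ ilt] /=.
  exact: ltn_trans ilt G2.
Qed.

(** Each block contributes two consecutive terms of the alternating sum, with signs reversed. The
    blocks are disjoint and end before [M (G r.*2)], whence the bound. *)
Lemma size_merged (X : Type) (u : nat -> seq X) (M G : nat -> nat) r :
  strictly_increasing M -> strictly_increasing G ->
  (forall i j, i <= j -> size (concat_at u (iota i (j - i))) = M j - M i) ->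
  ((size (concat_at u (merged_indices G r)))%:Z =
     - \sum_(i < r.*2) (-1) ^+ i * (M (G i))%:Z)%R /\
  size (concat_at u (merged_indices G r)) <= M (G r.*2).
Proof.
move=> M_incr G_incr szu; elim: r => [|r [IHs IHle]].
  by rewrite big_ord0 GRing.oppr0.
have G1 := G_incr _ _ (ltnSn r.*2); have G2 := G_incr _ _ (ltnSn r.*2.+1).
have M1 := M_incr _ _ G1; have M2 := M_incr _ _ G2.
rewrite merged_indicesS /concat_at map_cat flatten_cat size_cat.
rewrite -!/(concat_at _ _) szu ?(ltnW G1) // doubleS; split; last by lia.
rewrite !big_ord_recr /= GRing.exprS -[((-1) ^+ r.*2)%R]GRing.signr_odd odd_double GRing.expr0.
move: IHs; move: (\sum_(i < _) _)%R (size _) => S s; lia.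
Qed.

(** Past its last entry [k] is continued in steps of 1, so that the lemmas on merged blocks can take
    an increasing function on all of [nat]. *)
Lemma extend_increasing k : sorted ltn k ->
  exists2 K, strictly_increasing K & forall i, i < size k -> K i = nth 0 k i.
Proof.
move=> srt; exists (fun i => nth 0 k (minn i (size k).-1) + (i - (size k).-1)).
  apply: homo_ltn; first exact: ltn_trans.
  move=> i; case: (ltnP i (size k).-1) => ik.
    have -> : minn i.+1 (size k).-1 = i.+1 by lia.
    have := sorted_ltn_nth ltn_trans 0 srt i i.+1; rewrite !inE; lia.
  have -> : minn i.+1 (size k).-1 = (size k).-1 by lia.
  lia.
move=> i ik; have -> : minn i (size k).-1 = i by lia.
lia.
Qed.

(** A relation, since [s] need not occur in [x]; [q] is the start of its first occurrence. The last
    equation is additive to avoid truncated subtraction. *)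
Definition word_pair (X : Type) (x : nat -> X) (h : nat -> nat) (w : seq X)
    (p : nat * nat) : Prop :=
  let s := drop (h (size w)) w in
  exists q, [/\ s = mkseq (suffix_from q x) (size s),
    new_block X x q (q + size s), p.2 = q + size s & p.1 + size w = p.2].

Lemma word_pair_unique (X : Type) (x : nat -> X) h w p p' :
  word_pair X x h w p -> word_pair X x h w p' -> p = p'.
Proof.
move=> [q [sq nq p2 p1]] [q' [sq' nq' p2' p1']].
have qq : q = q' by apply: new_block_unique nq nq' _; rewrite -sq.
by case: p p' p1 p2 p1' p2' => [a b] [a' b'] /=; rewrite -qq => *; congr (_, _); lia.
Qed.

(** At least [a >= size v] letters are deleted, so [v] disappears. The rest starts in [x] at most
    [h (size w)] after [a], hence no later than [2 h(b)]: this is why [h_new] has a factor 2. *)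
Lemma word_pair_merged (X : Type) (x : nat -> X) (h : nat -> nat)
    (w v z : seq X) a b :
  {homo h : i j / i <= j} ->
  (forall b a, a <= (h b).*2 -> new_block X x a b) ->
  a <= b -> z = mkseq (suffix_from a x) (b - a) -> w = v ++ z ->
  size v <= a -> a <= h (size z) ->
  word_pair X x h w (b - size w, b).
Proof.
move=> h_homo h_new ab zE -> va az; rewrite /word_pair.
have szz : size z = b - a by rewrite zE size_mkseq.
rewrite size_cat; set N := size v + size z.
have Nb : N <= b by lia.
have hN : a <= h N by apply: leq_trans az (h_homo _ _ _); lia.
have hb := h_homo _ _ Nb.
(* Otherwise a new block would start at [2 h(N) > 0] and end at [N], which forces [2 h(N) < N]. *)
have hNN : h N <= N.
  rewrite leqNgt; apply/negP => hgt.
  have /h_new/(_ 0) : (h N).*2 <= (h N).*2 by [].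
  case; [lia | move=> i; lia].
have -> : drop (h N) (v ++ z) = mkseq (suffix_from (a + (h N - size v)) x) (N - h N).
  rewrite drop_cat ltnNge (leq_trans va hN) /= zE /mkseq -map_drop drop_iota.
  rewrite add0n -[X in iota X _]addn0 iotaDl -map_comp.
  have -> : b - a - (h N - size v) = N - h N by lia.
  by apply: eq_map => i; rewrite /= /suffix_from addnA.
exists (a + (h N - size v)); rewrite size_mkseq; split=> //=; try lia.
apply: h_new.
have -> : a + (h N - size v) + (N - h N) = b by lia.
lia.
Qed.

Theorem theorem3
    (htheta : exists (C : finType) (theta : natpair -> C),
        ~ exists m : nat -> nat,
            strictly_increasing m /\ alternating_monochromatic theta m)
    (X : Type) (x : nat -> X) (hx : ~ eventually_periodic x) :
  exists (D : finType) (c : seq X -> D),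
    forall n : nat,
      ~ exists u : nat -> seq X,
          factorisation (suffix_from n x) u /\ super_monochromatic c u.
Proof.
have [C [theta no_mono]] := htheta.
have [h [B [h_homo hB h_new]]] := slow_function X x hx.
(* Uniqueness of the pair makes the colour well defined; a word without a pair gets the colour of
   [(0, 1)]. *)
have colour w : exists d, forall p, word_pair X x h w (val p) -> d = theta p.
  have [[p wp]|no_p] := pselect (exists p : natpair, word_pair X x h w (val p)).
    exists (theta p) => p' wp'; congr theta; apply: val_inj.
    exact: word_pair_unique wp wp'.
  exists (theta (exist _ (0, 1) isT)) => p wp; case: no_p; by exists p.
have [c cP] := choice colour.
exists C, c => n [u [/factorisation_block[M M_incr uM] [d dP]]].
have M_mono : {homo M : i j / i <= j} := ltnW_homo M_incr.
apply: no_mono.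
(* A block starting at [M (g j)] is then longer than [B (M (g j))], so [h] of its length is at least
   its starting position. *)
pose g := fix g i := if i is j.+1 then (g j + B (M (g j))).+1 else 0.
have g_incr : strictly_increasing g.
  by apply: homo_ltn => [|i /=]; [exact: ltn_trans | rewrite ltnS leq_addr].
have M_add i e : M i + e <= M (i + e).
  elim: e => [|e IH]; rewrite ?addn0 // !addnS.
  exact: leq_ltn_trans IH (M_incr _ _ (ltnSn _)).
have g_long i j : i < j -> M (g i) <= h (M (g j) - M (g i)).
  move=> ij; apply: hB.
  have : M (g i.+1) <= M (g j).
    by apply: M_mono; apply: (ltnW_homo g_incr).
  have := M_add (g i) (B (M (g i))).+1; rewrite addnS /= addnS; lia.
exists (M \o g); split; first by move=> i j ij; apply/M_incr/g_incr.
exists d => -[[a b] ab] [t [k [t_odd szk srt /= aE bE]]].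
have [K K_incr KE] := extend_increasing k srt.
have tE : t = t./2.*2.+1 by rewrite -[LHS]odd_double_half t_odd.
(* The [t + 1 = 2 (r + 1)] cut points bound [r + 1] blocks: the first [r] form [v], the last one is
   [z]. *)
set r := t./2 in tE; pose G := g \o K.
have G_incr : strictly_increasing G by move=> i j ij; apply/g_incr/K_incr.
have szu i j : i <= j -> size (concat_at u (iota i (j - i))) = M j - M i.
  by move=> /uM ->; rewrite size_mkseq.
have [szv v_le] := size_merged X u M G r M_incr G_incr szu.
have [szw _] := size_merged X u M G r.+1 M_incr G_incr szu.
have G1 := G_incr _ _ (ltnSn r.*2).
have {}bE : b = M (G r.*2.+1) by rewrite bE /G /= -KE ?szk -?tE.
have szab : a + size (concat_at u (merged_indices G r.+1)) = b.
  suff : (a%:Z = \sum_(i < t) (-1) ^+ i * (M (G i))%:Z)%R.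
    rewrite tE => {}aE; move: szw; rewrite doubleS big_ord_recr /= -aE bE.
    rewrite GRing.exprS -[((-1) ^+ r.*2)%R]GRing.signr_odd odd_double GRing.expr0; lia.
  by rewrite aE; apply: eq_bigr => i _; rewrite /G /= KE // szk ltnS ltnW.
have [w_sorted _] := andP (merged_indices_sorted G r.+1 G_incr).
rewrite -(dP (merged_indices G r.+1)) //; last first.
  move=> /(congr1 size); rewrite merged_indicesS size_cat size_iota /=; lia.
symmetry; apply: cP => /=.
have -> : a = b - size (concat_at u (merged_indices G r.+1)) by rewrite -szab addnK.
rewrite bE.
apply: (word_pair_merged X x h _ (concat_at u (merged_indices G r)) _ (M (G r.*2)))
  (uM _ _ (ltnW G1)) _ v_le _ => //.
- exact/M_mono/ltnW.
- by rewrite merged_indicesS /concat_at map_cat flatten_cat.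
- by rewrite szu ?(ltnW G1) //; apply/g_long/K_incr.
Qed.
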